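(* For every positive integer $k$ and every real $1 < c \leq 2$, \[ g\left(n, k, \left\lceil \frac{(c-1)(k-1)}{c} \right\rceil^2\right) = o(n^c) \] as $n \to \infty$.
   Context: For a finite set $A \subseteq \mathbb{R}$, the difference set is $A - A = \{|a-b| : a, b \in A,\ a \neq b\}$ (only positive differences are counted). A set $A$ has the $(k,\ell)$-local property if every $k$-element subset $A' \subseteq A$ satisfies $|A' - A'| \geq \ell$. For integers $n \geq k \geq 1$ and real $\ell$, $g(n,k,\ell)$ is the minimum of $|A - A|$ over all $n$-element sets $A \subseteq \mathbb{R}$ with the $(k,\ell)$-local property, and $g(n,k,\ell) = +\infty$ if no such set exists. In asymptotic notation, $k$ and $c$ are fixed and $n \to \infty$. *)

(* Defs.v *)
From mathcomp Require Import all_boot all_order all_algebra finmap.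
From mathcomp Require Import all_classical all_reals all_analysis.
Import Order.TTheory GRing.Theory Num.Theory.
Import numFieldNormedType.Exports.

Set Implicit Arguments.
Unset Strict Implicit.
Unset Printing Implicit Defensive.

Local Open Scope classical_set_scope.
Local Open Scope ring_scope.

Definition difference_set (R : realType) (A : {fset R}) : {fset R} :=
  [fset `|a - b| | a in A, b in A & a != b]%fset.

Definition local_property (R : realType) (k : nat) (l : R) (A : {fset R}) : Prop :=
  forall A' : {fset R}, (A' `<=` A)%fset -> #|` A'|%fset = k ->
    l <= #|` difference_set A'|%fset%:R.

(* The infimum of a nonempty set of natural numbers is its minimum, and
   [ereal_inf set0 = +oo]. *)
Definition g (R : realType) (n k : nat) (l : R) : \bar R :=
  ereal_inf [set (#|` difference_set A|%fset%:R)%:E |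
             A in [set A : {fset R} | #|` A|%fset = n /\ local_property k l A]].

(* Main.v *)
(* Let [L] be the ceiling of [(c - 1) (k - 1) / c], so that [2 L <= k] and
   [c (k - L) > k - 1].

   The core fact is that integers [x_0 < ... < x_(k-1)] with fewer than [L ^ 2]
   differences satisfy at least [k - L] independent relations of the form
   [x_i + x_j = x_u + x_v].  Add the points in increasing order, and let [m] be
   the rank of the relations among the points [x_0, ..., x_p].  If [w] of the
   differences [x_p - x_a] already occur among the previous points, then the
   corresponding relations [x_p + x_u = x_v + x_a] have [u < v, a < p], and a
   triangularity argument extracts [w / 2] independent ones, so that
   [w <= 2 m]; moreover [m] has increased if [w > 0].  Summing the number of new
   differences gives the claim.

   Consequently only [O (N ^ L)] of the [k]-subsets of [{0, ..., N - 1}] have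
   fewer than [L ^ 2] differences.  Removing points of large degree one by one
   leaves a set of size [2 n] with at most [O (N ^ L (n / N) ^ k)] such subsets.
   For [N ~ e n ^ c] this is at most [n], because [c (k - L) > k - 1], and
   deleting one point from each of them leaves [n] points of [{0, ..., N - 1}]
   with the local property and at most [N] differences. *)

Require Import Defs.
From mathcomp Require Import all_boot all_order all_algebra finmap.
From mathcomp Require Import all_classical all_reals all_analysis.
From mathcomp Require Import zify ring lra.
Import Order.TTheory GRing.Theory Num.Theory.
Import numFieldNormedType.Exports.

Set Implicit Arguments.
Unset Strict Implicit.
Unset Printing Implicit Defensive.

Local Open Scope ring_scope.

(** * Linear algebra: triangular families and initial coordinates *)

(** In a vanishing combination of the chosen rows, let [a] be the largest index with a non-zero
    coefficient. At coordinate [a] only its own row contributes, a contradiction; so the rows are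
    independent. *)
Lemma echelon_leq_rank (F : fieldType) (m k : nat) (S : 'M[F]_(m, k))
    (U : {set 'I_k}) :
  (forall a, a \in U -> exists r : 'rV[F]_k, [/\ (r <= S)%MS, r 0 a != 0 &
     forall b, b \in U -> (a < b)%N -> r 0 b = 0]) ->
  (#|U| <= \rank S)%N.
Proof.
move=> H.
have /choice[r Hr] : forall a, exists r : 'rV[F]_k, a \in U ->
    [/\ (r <= S)%MS, r 0 a != 0 & forall b, b \in U -> (a < b)%N -> r 0 b = 0].
  move=> a; case: (boolP (a \in U)) => [/H[r Hr]|_]; first by exists r.
  by exists 0.
pose G : 'M[F]_(#|U|, k) := \matrix_(i < #|U|) r (enum_val i).
have GS : (G <= S)%MS.
  by apply/row_subP => i; rewrite rowK; case: (Hr _ (enum_valP i)).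
have /eqP <- : row_free G.
  apply: inj_row_free => v vG0; apply/rowP => i; rewrite mxE.
  apply/eqP/negPn/negP => vi_neq0.
  case: (@arg_maxnP _ i (fun i => v 0 i != 0) (fun i => val (enum_val i)) vi_neq0).
  move=> {vi_neq0}i vi_neq0 imax.
  have := congr1 (fun w : 'rV_k => w 0 (enum_val i)) vG0.
  rewrite !mxE (bigD1 i) //= big1 ?addr0 => [|j j_neq_i].
    rewrite mxE; case: (Hr _ (enum_valP i)) => _ ri _ /eqP.
    by rewrite mulf_eq0 (negPf vi_neq0) (negPf ri).
  rewrite mxE; case: (Hr _ (enum_valP j)) => _ _ rj.
  have [->|vj_neq0] := eqVneq (v 0 j) 0; first by rewrite mul0r.
  rewrite rj ?mulr0 ?enum_valP //.
  have ji : (enum_val j <= enum_val i)%N by exact: imax.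
  rewrite ltn_neqAle ji andbT; apply: contra_neq j_neq_i => /val_inj.
  exact: enum_val_inj.
exact: mxrankS.
Qed.

(** The row space of [pid_mx i] is the space of vectors supported on the first [i] coordinates;
    intersecting with it keeps the relations among the first [i] points. *)
Lemma delta_sub_pid (F : fieldType) (k i : nat) (j : 'I_k) :
  (j < i)%N -> ((delta_mx 0 j : 'rV[F]_k) <= (pid_mx i : 'M[F]_k))%MS.
Proof.
move=> ji; suff -> : delta_mx 0 j = row j (pid_mx i : 'M[F]_k) by exact: row_sub.
by apply/rowP => l; rewrite !mxE /= ji andbT eq_sym.
Qed.

Lemma sub_pid_eq0 (F : fieldType) (k i : nat) (v : 'rV[F]_k) (j : 'I_k) :
  (v <= (pid_mx i : 'M[F]_k))%MS -> (i <= j)%N -> v 0 j = 0.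
Proof.
case/submxP => w -> ij; rewrite mxE big1 // => l _; rewrite mxE.
by case: eqP => [->|_] /=; rewrite ?mulr0 // ltnNge ij mulr0.
Qed.

Lemma pid_subS (F : fieldType) (k i : nat) :
  ((pid_mx i : 'M[F]_k) <= (pid_mx i.+1 : 'M[F]_k))%MS.
Proof.
apply/row_subP => j; have [ji|ij] := ltnP j i.
  suff -> : row j (pid_mx i) = row j (pid_mx i.+1 : 'M[F]_k) by exact: row_sub.
  by apply/rowP => l; rewrite !mxE /= ji ltnW.
suff -> : row j (pid_mx i) = 0 :> 'rV[F]_k by exact: sub0mx.
by apply/rowP => l; rewrite !mxE /= ltnNge ij andbF.
Qed.

(** The upper bound is the dimension formula for [S :&: E'] and [E]: they meet in [S :&: E], and
    their sum lies in [E'], of rank one more than [E]. *)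
Lemma rank_cap_pidS (F : fieldType) (k i : nat) (S : 'M[F]_k) : (i < k)%N ->
  (\rank (S :&: (pid_mx i : 'M[F]_k)) <=
     \rank (S :&: (pid_mx i.+1 : 'M[F]_k)) <=
     (\rank (S :&: (pid_mx i : 'M[F]_k))).+1)%N.
Proof.
move=> ik; apply/andP; split; first by rewrite mxrankS ?capmxS ?pid_subS.
set E := pid_mx i; set E' := pid_mx i.+1.
have := mxrank_sum_cap (S :&: E')%MS E.
have -> : \rank ((S :&: E') :&: E) = \rank (S :&: E).
  apply/eqP; rewrite eqn_leq; apply/andP; split; apply: mxrankS.
    by rewrite capmxS ?capmxSl.
  by rewrite !sub_capmx capmxSl capmxSr (submx_trans (capmxSr _ _)) ?pid_subS.
have : (\rank ((S :&: E')%MS + E)%MS <= \rank E')%N.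
  by rewrite mxrankS // addsmx_sub capmxSr pid_subS.
rewrite /E /E' !rank_pid_mx ?(ltnW ik) //; lia.
Qed.

(** * Additive relations and repeated differences *)

Definition additive_relation (k : nat) (i j u v : 'I_k) : 'rV[rat]_k :=
  delta_mx 0 i + delta_mx 0 j - delta_mx 0 u - delta_mx 0 v.

(** The truncated subtraction gives true differences when [x] is increasing. *)
Definition initial_gaps (k : nat) (x : 'I_k -> nat) (i : nat) : {fset nat} :=
  [fset (x w.2 - x w.1)%N | w in [pred w : 'I_k * 'I_k | w.1 < w.2 < i]%N]%fset.

Lemma initial_gapsP (k : nat) (x : 'I_k -> nat) (i d : nat) :
  reflect (exists u v : 'I_k, [/\ u < v, v < i & d = x v - x u]%N)
    (d \in initial_gaps x i).
Proof.
apply: (iffP idP) => [/imfsetP[[u v] /= /andP[uv vi] ->]|[u [v [uv vi ->]]]].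
  by exists u, v.
by apply/imfsetP; exists (u, v) => //; apply/andP.
Qed.

(** The differences [x p - x a] with [a < p] are pairwise distinct, and those outside
    [initial_gaps x p] are new. *)
Lemma initial_gapsS (k : nat) (x : 'I_k -> nat) (p : 'I_k) :
  (forall i j : 'I_k, (i < j)%N -> (x i < x j)%N) ->
  (#|` initial_gaps x p| + p <= #|` initial_gaps x p.+1| +
    #|[set a : 'I_k | (a < p)%N & (x p - x a)%N \in initial_gaps x p]|)%N.
Proof.
move=> xlt; set W := [set a | _ & _].
pose V := [set a : 'I_k | (a < p)%N & (x p - x a)%N \notin initial_gaps x p].
have VW : (#|V| + #|W| = p)%N.
  have winj : injective (widen_ord (ltnW (ltn_ord p))).
    by move=> a b /(congr1 val) /= /val_inj.
  rewrite -[RHS](card_ord p) -[RHS](card_imset _ winj).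
  rewrite addnC -cardsUI [W :&: V](_ : _ = finset.set0) ?cards0 ?addn0.
    apply: eq_card => a; rewrite !inE -andb_orr orbN andbT.
    apply/idP/imsetP => [ap|[b _ ->]]; last exact: (ltn_ord b).
    by exists (Ordinal ap) => //; apply/val_inj.
  by apply/setP => a; rewrite !inE; case: (_ \in _); rewrite !andbF.
pose T := [fset (x p - x a)%N | a in V]%fset.
have cT : #|` T| = #|V|.
  rewrite card_in_imfset //= -?cardE // => a b.
  rewrite !inE => /andP[/xlt ap _] /andP[/xlt bp _] xab.
  have {ap bp}xab : x a = x b by lia.
  by apply/val_inj; case: (ltngtP a b) => // /xlt; rewrite xab ltnn.
have dT : [disjoint initial_gaps x p & T]%fset.
  apply/fdisjointP => d dp; apply/negP => /imfsetP[a /=].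
  rewrite inE => /andP[_ /negP xa] da.
  by apply: xa; rewrite -da.
have sub : (initial_gaps x p `|` T `<=` initial_gaps x p.+1)%fset.
  apply/fsubsetP => d; rewrite in_fsetU => /orP[/initial_gapsP[u [v [uv vp ->]]]|].
    by apply/initial_gapsP; exists u, v; split=> //; apply: ltnW.
  case/imfsetP => a /=; rewrite inE => /andP[ap _] ->.
  by apply/initial_gapsP; exists a, p.
have := fsubset_leq_card sub.
by rewrite cardfsU (eqP dT) cardfs0 subn0 cT; lia.
Qed.

Lemma additive_relationE (k : nat) (i j u v b : 'I_k) :
  additive_relation i j u v 0 b =
    (b == i)%:R + (b == j)%:R - (b == u)%:R - (b == v)%:R.
Proof. by rewrite !mxE. Qed.

Lemma additive_relation_sub_pid (k n : nat) (i j u v : 'I_k) :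
  (i < n)%N -> (j < n)%N -> (u < n)%N -> (v < n)%N ->
  (additive_relation i j u v <= (pid_mx n : 'M[rat]_k))%MS.
Proof.
move=> ii jn un vn; rewrite /additive_relation.
by rewrite !addmx_sub ?eqmx_opp ?delta_sub_pid.
Qed.

Lemma repeated_gaps_rank (k : nat) (x : 'I_k -> nat) (S : 'M[rat]_k) (p : 'I_k) :
  (forall i j : 'I_k, (i < j)%N -> (x i < x j)%N) ->
  (forall i j u v : 'I_k, (x i + x j = x u + x v)%N ->
     (additive_relation i j u v <= S)%MS) ->
  let W := [set a : 'I_k | (a < p)%N & (x p - x a)%N \in initial_gaps x p] in
  (#|W| <= (\rank (S :&: (pid_mx p.+1 : 'M[rat]_k))).*2)%N /\
  ((0 < #|W|)%N -> (\rank (S :&: (pid_mx p : 'M[rat]_k)) <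
     \rank (S :&: (pid_mx p.+1 : 'M[rat]_k)))%N).
Proof.
move=> xlt Srel W; set E := (S :&: (pid_mx p.+1 : 'M[rat]_k))%MS.
have ltx i j : (x i < x j)%N = (i < j)%N.
  case: (ltngtP i j) => [/xlt->//|/xlt ji|/val_inj->]; last by rewrite ltnn.
  by apply/negbTE; rewrite -leqNgt ltnW.
have Wrel a : a \in W -> exists u v : 'I_k,
    [/\ (x p + x u = x v + x a)%N, u < v, v < p, u < a & a < p]%N.
  rewrite inE => /andP[ap /initial_gapsP[u [v [uv vp xpa]]]]; exists u, v.
  have xuv := xlt _ _ uv; have xvp := xlt _ _ vp; have xap := xlt _ _ ap.
  by split => //; [lia | rewrite -ltx; lia].
have relE u v a : (x p + x u = x v + x a)%N -> (u < p)%N -> (v < p)%N ->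
    (a < p)%N -> (additive_relation p u v a <= E)%MS.
  move=> xr up vp ap; rewrite sub_capmx Srel //.
  by rewrite additive_relation_sub_pid ?ltnS ?(ltnW up) ?(ltnW vp) ?(ltnW ap).
(* An element of [big] is the largest one, after [p], of its relation, and an
   element of [W :\: big] is the second smallest one, the other middle element
   lying in [big].  Hence the relations are triangular on either set. *)
pose big := [set a : 'I_k | [exists u : 'I_k, exists v : 'I_k,
  [&& (x p + x u == x v + x a)%N, (u < v)%N, (v <= a)%N & (a < p)%N]]].
have big_rank : (#|big| <= \rank E)%N.
  apply: echelon_leq_rank => a; rewrite inE.
  case/existsP => u /existsP[v /and4P[/eqP xr uv va ap]].
  exists (additive_relation p u v a); split; first by apply: relE; lia.
    rewrite additive_relationE eqxx -!val_eqE /=.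
    rewrite (_ : (a == p :> nat) = false); last by lia.
    rewrite (_ : (a == u :> nat) = false); last by lia.
    (* The coefficient is -2 when [v = a], still non-zero in [rat]. *)
    by case: (a == v :> nat).
  move=> b; rewrite inE => /existsP[u' /existsP[v' /and4P[_ _ _ bp]]] ab.
  rewrite additive_relationE -!val_eqE /=.
  rewrite (_ : (b == p :> nat) = false); last by lia.
  rewrite (_ : (b == u :> nat) = false); last by lia.
  rewrite (_ : (b == v :> nat) = false); last by lia.
  by rewrite (_ : (b == a :> nat) = false); last by lia.
have small_rank : (#|W :\: big| <= \rank E)%N.
  apply: echelon_leq_rank => a; rewrite inE => /andP[abig aW].
  have [u [v [xr uv vp ua ap]]] := Wrel a aW.
  have av : (a < v)%N.
    rewrite ltnNge; apply: contra abig => va; rewrite inE.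
    by apply/existsP; exists u; apply/existsP; exists v; rewrite xr eqxx uv va.
  (* Exchanging [v] and [a] in the relation puts [v] in [big], so [v] is not an index of this second
     triangular family. *)
  have vbig : v \in big.
    rewrite inE; apply/existsP; exists u; apply/existsP; exists a.
    by rewrite xr addnC eqxx ua (ltnW av).
  exists (additive_relation p u v a); split; first by apply: relE; lia.
    rewrite additive_relationE eqxx -!val_eqE /=.
    rewrite (_ : (a == p :> nat) = false); last by lia.
    rewrite (_ : (a == u :> nat) = false); last by lia.
    by rewrite (_ : (a == v :> nat) = false); last by lia.
  move=> b; rewrite inE => /andP[bbig bW] ab.
  have bv : (b == v) = false by apply/eqP => bv; rewrite bv vbig in bbig.
  have [_ [_ [_ _ _ _ bp]]] := Wrel b bW.
  rewrite additive_relationE bv -!val_eqE /=.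
  rewrite (_ : (b == p :> nat) = false); last by lia.
  rewrite (_ : (b == u :> nat) = false); last by lia.
  by rewrite (_ : (b == a :> nat) = false); last by lia.
split.
  have := cardsID big W; have := subset_leq_card (subsetIr W big).
  by move: big_rank small_rank; lia.
case/card_gt0P => a /Wrel[u [v [xr uv vp ua ap]]].
(* The relation has coefficient 1 at [p], so it does not lie among those of the first [p] points. *)
apply: rank_ltmx; rewrite ltmxE capmxS ?pid_subS //=.
apply/negP => EE.
have := submx_trans (relE _ _ _ xr (ltn_trans uv vp) vp ap) EE.
rewrite sub_capmx => /andP[_ /sub_pid_eq0 /(_ (leqnn p))].
rewrite additive_relationE eqxx -!val_eqE /=.
rewrite (_ : (p == u :> nat) = false); last by lia.
rewrite (_ : (p == v :> nat) = false); last by lia.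
by rewrite (_ : (p == a :> nat) = false); last by lia.
Qed.

Lemma few_gaps_rank (k L : nat) (x : 'I_k -> nat) (S : 'M[rat]_k) :
  (forall i j : 'I_k, (i < j)%N -> (x i < x j)%N) ->
  (forall i j u v : 'I_k, (x i + x j = x u + x v)%N ->
     (additive_relation i j u v <= S)%MS) ->
  (L.*2 <= k)%N -> (#|` initial_gaps x k| < L ^ 2)%N -> (k - L <= \rank S)%N.
Proof.
move=> xlt Srel Lk few; rewrite leqNgt; apply/negP => rS.
pose m i := \rank (S :&: (pid_mx i : 'M[rat]_k)).
(* [j * j.+1] bounds the number of coincidences among [d + j] points whose
   relations have rank [j]; allowing every [j <= m i], and not only [j = m i], covers the steps
   where the bound [i - 2 m] on the number of new differences is negative. *)
have inv i : (i <= k)%N -> (m i <= i)%N /\ forall j, (j <= m i)%N ->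
    ((i - m i + j) * (i - m i + j).-1 <=
       (#|` initial_gaps x i|).*2 + (j * j.+1).*2)%N.
  elim: i => [_|i IH ik].
    have m0 : m 0%N = 0%N by rewrite /m pid_mx_0 capmx0 mxrank0.
    by rewrite m0; split=> // j; rewrite leqn0 => /eqP ->.
  have [mi IHj] := IH (ltnW ik); pose p := Ordinal ik.
  have := initial_gapsS p xlt; have [] := repeated_gaps_rank p xlt Srel.
  rewrite /= -/(m i) -/(m i.+1); set w := #|[set a | _ & _]|.
  set D := #|` initial_gaps x i|; set D' := #|` initial_gaps x i.+1|.
  move=> w2 wm DD'.
  have /andP[mm mm'] : (m i <= m i.+1 <= (m i).+1)%N by exact: rank_cap_pidS.
  split; first by lia.
  have [same|grow] := eqVneq (m i.+1) (m i).
    (* If the rank is unchanged, no difference repeats and all [i] of them are new. *)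
    have w0 : w = 0%N by move: wm; rewrite same ltnn; lia.
    move=> j; rewrite same => jm; have := IHj j jm; rewrite subSn // -/D.
    by set d := (i - m i)%N; have id : (i = d + m i)%N by [lia|rewrite /d; lia]; nia.
  have grow' : m i.+1 = (m i).+1 by lia.
  rewrite grow' subSS => j; rewrite leq_eqVlt => /orP[/eqP->|jm]; last first.
    apply: leq_trans (IHj j jm) _; rewrite leq_add2r leq_double.
    apply: fsubset_leq_card; apply/fsubsetP => d /initial_gapsP[u [v [uv vi ->]]].
    by apply/initial_gapsP; exists u, v; split=> //; apply: ltnW.
  (* For the new value [j = m i + 1], at most [2 j] of the [i] differences repeat; twice this loss
     is covered by the growth [4 j] of [2 j (j + 1)]. *)
  have := IHj _ (leqnn _); rewrite -/D; move: w2; rewrite grow'.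
  have : (i - m i + m i = i)%N by rewrite subnK.
  by set d := (i - m i)%N; nia.
have [_ invk] := inv k (leqnn k).
have mS : (m k <= \rank S)%N by rewrite mxrankS // capmxSl.
set D := #|` _| in few invk.
(* Put [d = k - m k > L]. If [d - 1 <= m k], taking [j = d - 1] yields at least
   [(d - 1) ^ 2 >= L ^ 2] differences. Otherwise [2 m k <= k - 2], and [j = m k] yields at least
   [k ^ 2 / 4 >= L ^ 2]. *)
have [md|dm] := leqP (k - m k).-1 (m k).
  by have := invk _ md; nia.
by have := invk _ (leqnn _); nia.
Qed.

(** * Counting the sets with few differences *)

(** The kernel has dimension at most [L], and an invertible square block of rows in a matrix of
    basis columns selects coordinates that determine its vectors. *)
Lemma kernel_free_coordinates (F : fieldType) (k L : nat) (M : 'M[F]_k) :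
  (0 < k)%N -> (k - L <= \rank M)%N ->
  exists f : 'I_L -> 'I_k, forall z : 'cV[F]_k,
    M *m z = 0 -> (forall j, z (f j) 0 = 0) -> z = 0.
Proof.
move=> k_gt0 rM; pose K := kermx M^T; pose A := (row_base K)^T.
have rK : (\rank K <= L)%N.
  by rewrite mxrank_ker mxrank_tr leq_subLR addnC -leq_subLR.
have fullA : row_full A by rewrite /row_full mxrank_tr; exact: row_base_free.
pose h := fullrankfun fullA.
(* When the kernel has dimension below [L], the spare indices are sent to coordinate 0. *)
exists (fun j => oapp h (Ordinal k_gt0) (insub (val j))) => z Mz0 zh0.
have /submxP[c zc] : (z^T <= row_base K)%MS.
  by rewrite eq_row_base; apply/sub_kermxP; rewrite -trmx_mul Mz0 trmx0.
have zA : z = A *m c^T by rewrite -trmx_mul -zc trmxK.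
suff c0 : c^T = 0 by rewrite zA c0 mulmx0.
rewrite -[c^T](mulKmx (fullrowsub_unit fullA)) -/h.
suff -> : rowsub h A *m c^T = 0 by rewrite mulmx0.
rewrite mul_rowsub_mx -zA; apply/matrixP => i j; rewrite !mxE ord1.
by have := zh0 (widen_ord rK i); rewrite /= valK.
Qed.

Definition gaps (N : nat) (B : {set 'I_N}) : {fset nat} :=
  [fset (val w.2 - val w.1)%N | w in
    [pred w : 'I_N * 'I_N | [&& w.1 \in B, w.2 \in B & w.1 < w.2]%N]]%fset.

Definition few_gaps_sets (N k L : nat) : {set {set 'I_N}} :=
  [set B : {set 'I_N} | (#|B| == k) && (#|` gaps B| < L ^ 2)%N].

Lemma nth_enum_ord_set_ltn (N : nat) (i0 : 'I_N) (B : {set 'I_N}) (i j : nat) :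
  (i < j)%N -> (j < #|B|)%N -> (nth i0 (enum B) i < nth i0 (enum B) j)%N.
Proof.
move=> ij jB; apply: (sorted_ltn_nth (leT := relpre val ltn)) => //.
- by move=> a b c; apply: ltn_trans.
- rewrite -sorted_map -[enum _](eq_filter (mem_enum _)).
  rewrite -(eq_filter (mem_map val_inj _)) -filter_map.
  by rewrite (sorted_filter ltn_trans) // unlock val_ord_enum iota_ltn_sorted.
- by rewrite inE -cardE (ltn_trans ij).
- by rewrite inE -cardE.
Qed.

(** The set of all relations among the points of [B] defines a linear system with solution space of
    dimension at most [L]; so [B] is encoded by this set and the values of [L] free points. *)
Lemma card_few_gaps_sets (N k L : nat) :
  (0 < k)%N -> (L.*2 <= k)%N ->
  (#|few_gaps_sets N k L| <=
     #|{set 'I_k * 'I_k * 'I_k * 'I_k}| * N ^ L)%N.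
Proof.
move=> k_gt0 Lk; case: N => [|N].
  rewrite (_ : few_gaps_sets 0 k L = finset.set0) ?cards0 //.
  apply/setP => B; rewrite !inE; apply/negP => /andP[/eqP Bk _].
  have /card_gt0P[[]] : (0 < #|B|)%N by rewrite Bk.
  by [].
pose Q := {set 'I_k * 'I_k * 'I_k * 'I_k}.
pose rels (q : Q) : 'M[rat]_k :=
  (\sum_(r in q) <<additive_relation r.1.1.1 r.1.1.2 r.1.2 r.2>>)%MS.
have /choice[free freeP] : forall q : Q, exists f : 'I_L -> 'I_k,
    (k - L <= \rank (rels q))%N -> forall z : 'cV[rat]_k,
      rels q *m z = 0 -> (forall j, z (f j) 0 = 0) -> z = 0.
  move=> q; case: (leqP (k - L) (\rank (rels q))) => [rq|_].
    by have [f fP] := kernel_free_coordinates k_gt0 rq; exists f.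
  by exists (fun => Ordinal k_gt0).
pose x (B : {set 'I_N.+1}) (i : 'I_k) := nth ord0 (enum B) i.
pose pat B : Q := [set r | (x B r.1.1.1 + x B r.1.1.2 == x B r.1.2 + x B r.2)%N].
pose code B := (pat B, [ffun j : 'I_L => x B (free (pat B) j)]).
have -> : (#|{set 'I_k * 'I_k * 'I_k * 'I_k}| * N.+1 ^ L =
    #|{: Q * {ffun 'I_L -> 'I_N.+1}}|)%N.
  by rewrite card_prod card_ffun !card_ord.
apply: (@leq_card_in _ _ code) => B C; rewrite !inE.
move=> /andP[/eqP Bk Bfew] /andP[/eqP Ck _] [patE] /ffunP valE.
have xlt (i j : 'I_k) : (i < j)%N -> (x B i < x B j)%N.
  by move=> ij; apply: nth_enum_ord_set_ltn; rewrite ?Bk.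
have xmem (i : 'I_k) : x B i \in B by rewrite -mem_enum mem_nth // -cardE Bk.
have relsE (D : {set 'I_N.+1}) : rels (pat D) *m (\col_i (x D i)%:R) = 0.
  apply/sub_kermxP/sumsmx_subP => r; rewrite inE genmxE => /eqP xr; apply/sub_kermxP.
  rewrite /additive_relation !mulmxBl mulmxDl -!rowE; apply/rowP => i; rewrite !mxE.
  by rewrite -natrD xr natrD; ring.
have rk : (k - L <= \rank (rels (pat B)))%N.
  apply: (few_gaps_rank (x := x B)) => //.
    move=> i j u v xr; apply: submx_trans (sumsmx_sup (i, j, u, v) _ (submx_refl _)).
      by rewrite genmxE.
    by rewrite inE /= xr.
  apply: leq_ltn_trans Bfew; apply: fsubset_leq_card; apply/fsubsetP => d.
  case/initial_gapsP => u [v [uv _ ->]]; apply/imfsetP; exists (x B u, x B v) => //.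
  by apply/and3P; split; rewrite ?xmem ?xlt.
(* The difference of the two point vectors solves the common system and vanishes at the free
   coordinates. *)
have xBC i : x B i = x C i.
  have /colP/(_ i) : \col_i (x B i)%:R - \col_i (x C i)%:R = 0 :> 'cV[rat]_k.
    apply: freeP rk _ _ _; first by rewrite mulmxBr relsE patE relsE subrr.
    move=> j; have := valE j; rewrite !ffunE -patE => xE.
    by rewrite !mxE xE subrr.
  by rewrite !mxE => /eqP; rewrite subr_eq0 eqr_nat => /eqP /val_inj.
suff enumE : enum B = enum C by apply/setP => i; rewrite -mem_enum enumE mem_enum.
apply: (@eq_from_nth _ ord0); rewrite -!cardE ?Bk ?Ck // => i ik.
exact: (xBC (Ordinal ik)).
Qed.

(** * Deletion of vertices in uniform hypergraphs *)

Definition edges_in (T : finType) (E : {set {set T}}) (S : {set T}) :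
    {set {set T}} :=
  [set B in E | B \subset S].

Lemma edges_in_setD1 (T : finType) (E : {set {set T}}) (S : {set T}) (v : T) :
  (#|edges_in E (S :\ v)| + #|[set B in edges_in E S | v \in B]| =
     #|edges_in E S|)%N.
Proof.
rewrite -(cardsID [set B : {set T} | v \in B] (edges_in E S)) addnC; congr (_ + _)%N.
  by apply: eq_card => B; rewrite !inE.
by apply: eq_card => B; rewrite !inE subsetD1 andbA andbC.
Qed.

(** Averaging: the degrees in [S] sum to [k] times the number of edges, and [v] is chosen to leave
    the fewest edges. The additive form avoids truncated subtraction. *)
Lemma remove_popular_vertex (T : finType) (E : {set {set T}}) (k : nat)
    (S : {set T}) :
  (forall B, B \in E -> #|B| = k) -> (0 < #|S|)%N ->
  exists2 v, v \in S & (#|edges_in E (S :\ v)| * #|S| + k * #|edges_in E S|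
    <= #|edges_in E S| * #|S|)%N.
Proof.
move=> Ek /card_gt0P[v0 v0S].
case: (arg_minnP (fun v => #|edges_in E (S :\ v)|) v0S) => v vS vmin.
exists v => //.
have degrees : (\sum_(u in S) #|[set B in edges_in E S | u \in B]| =
    k * #|edges_in E S|)%N.
  under eq_bigr do rewrite -sum1_card.
  rewrite (exchange_big_dep (mem (edges_in E S))) /=; last first.
    by move=> u B _; rewrite inE => /andP[].
  rewrite mulnC -sum_nat_const; apply: eq_bigr => B; rewrite inE => /andP[BE BS].
  rewrite -(Ek B BE) -sum1_card; apply: eq_bigl => u; rewrite !inE BE BS /=.
  by apply: andb_idl; apply: (fintype.subsetP BS).
rewrite -degrees mulnC -sum_nat_const mulnC -sum_nat_const -big_split.
by apply: leq_sum => u uS; rewrite -(edges_in_setD1 E S u) leq_add2r vmin.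
Qed.

(** For [s > 0] this is Bernoulli's inequality [1 - k / s <= (1 - 1 / s) ^ k], with denominators
    cleared. *)
Lemma bernoulli_nat (s k : nat) : ((s - k) * s ^ k <= s * s.-1 ^ k)%N.
Proof.
elim: k => [|k IH]; first by rewrite subn0.
rewrite !expnSr !mulnA; apply: leq_trans (leq_mul IH (leqnn s.-1)).
rewrite -!mulnA [(s ^ k * _)%N]mulnC [(s ^ k * _)%N]mulnC !mulnA.
by rewrite leq_mul2r; apply/orP; right; nia.
Qed.

(** Going from [s] to [s - 1] vertices multiplies the edge count by at most
    [1 - k / s <= ((s - 1) / s) ^ k], and these factors telescope. *)
Lemma sparse_subset (T : finType) (E : {set {set T}}) (k M : nat) :
  (forall B, B \in E -> #|B| = k) -> (M <= #|T|)%N ->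
  exists2 S : {set T}, #|S| = M &
    (#|edges_in E S| * #|T| ^ k <= #|E| * M ^ k)%N.
Proof.
move=> Ek; move: {2}(#|T| - M)%N (erefl (#|T| - M)%N) => d.
elim: d M => [|d IH] M dM MT.
  exists [set: T]%SET; first by rewrite cardsT; lia.
  have -> : M = #|T| by lia.
  rewrite leq_mul2r subset_leq_card ?orbT //.
  by apply/fintype.subsetP => B; rewrite inE => /andP[].
have [] := IH M.+1; [lia..|move=> S SM SE].
have [|v vS] := @remove_popular_vertex T E k S Ek; first by rewrite SM.
rewrite SM; set f := #|edges_in E S| in SE *; set f' := #|edges_in E _|.
move=> f'f; exists (S :\ v); first by have := cardsD1 v S; rewrite vS; lia.
rewrite -/f' -(leq_pmul2l (ltn0Sn M)).
have f'M : (M.+1 * f' <= (M.+1 - k) * f)%N by rewrite mulnBl; lia.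
rewrite mulnA (leq_trans (leq_mul f'M (leqnn _))) // -mulnA.
rewrite (leq_trans (leq_mul (leqnn _) SE)) // mulnCA [leqRHS]mulnCA leq_mul2l.
by rewrite bernoulli_nat orbT.
Qed.

Lemma independent_subset (T : finType) (E : {set {set T}}) (S : {set T})
    (t : nat) :
  (forall B, B \in E -> (0 < #|B|)%N) -> (#|edges_in E S| <= t)%N ->
  exists2 S' : {set T}, (#|S| <= #|S'| + t)%N &
    forall B, B \in E -> ~~ (B \subset S').
Proof.
move=> E0; elim: t S => [|t IH] S.
  rewrite leqn0 cards_eq0 => /eqP ES0; exists S => [|B BE]; first by rewrite addn0.
  by apply/negP => BS; have := finset.in_set0 B; rewrite -ES0 inE BE BS.
have [ES0 _|[B]] := set_0Vmem (edges_in E S).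
  have [|S' SS' S'E] := IH S; first by rewrite ES0 cards0.
  by exists S' => //; lia.
rewrite inE => /andP[BE BS] ESt; have /card_gt0P[v vB] := E0 B BE.
have vS : v \in S by apply: (fintype.subsetP BS).
have [|S' SS' S'E] := IH (S :\ v).
  have := edges_in_setD1 E S v.
  have : (0 < #|[set C in edges_in E S | v \in C]|)%N.
    by apply/card_gt0P; exists B; rewrite !inE BE BS.
  by move: ESt; lia.
by exists S' => //; have := cardsD1 v S; rewrite vS; lia.
Qed.

Lemma subset_of_card (T : finType) (S : {set T}) (n : nat) :
  (n <= #|S|)%N -> exists2 A : {set T}, A \subset S & #|A| = n.
Proof.
move=> nS; exists [set x in take n (enum S)].
  by apply/fintype.subsetP => x; rewrite inE => /mem_take; rewrite mem_enum.
rewrite cardsE; have /card_uniqP -> : uniq (take n (enum S)).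
  by rewrite take_uniq ?enum_uniq.
by rewrite size_takel // -cardE.
Qed.

(** For [n > 0] the last hypothesis says that [C N ^ L (2 n / N) ^ k <= n], where [C] is the number
    of relation patterns: a sparse set of [2 n] points then contains at most [n] bad subsets. *)
Lemma few_gaps_free_set (N n k L : nat) :
  (0 < N)%N -> (0 < k)%N -> (L.*2 <= k)%N -> (n.*2 <= N)%N ->
  (#|{set 'I_k * 'I_k * 'I_k * 'I_k}| * 2 ^ k * n ^ k.-1 <= N ^ (k - L))%N ->
  exists2 A : {set 'I_N}, #|A| = n &
    forall B : {set 'I_N}, B \subset A -> #|B| = k -> (L ^ 2 <= #|` gaps B|)%N.
Proof.
move=> N_gt0 k_gt0 Lk nN; set C := #|{set _}| => CN.
pose E := few_gaps_sets N k L.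
have Ek B : B \in E -> #|B| = k by rewrite inE => /andP[/eqP].
have [|S Sn SE] := @sparse_subset _ E k n.*2 Ek; first by rewrite card_ord.
have [||S' SS' S'E] := @independent_subset _ E S n.
- by move=> B /Ek ->.
- rewrite card_ord in SE; rewrite -(@leq_pmul2r (N ^ k)) ?expn_gt0 ?N_gt0 //.
  apply: leq_trans SE _.
  apply: leq_trans (leq_mul (card_few_gaps_sets N k_gt0 Lk) (leqnn _)) _.
  have -> : (N ^ k = N ^ L * N ^ (k - L))%N by rewrite -expnD subnKC //; lia.
  have -> : (n.*2 ^ k = n * n ^ k.-1 * 2 ^ k)%N.
    by rewrite -expnS prednK // -muln2 expnMn.
  rewrite -/C.
  have -> : (C * N ^ L * (n * n ^ k.-1 * 2 ^ k) =
      n * N ^ L * (C * 2 ^ k * n ^ k.-1))%N by lia.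
  by rewrite [leqRHS]mulnA leq_mul2l CN orbT.
have [|A AS' An] := @subset_of_card _ S' n; first by lia.
exists A => // B BA Bk; rewrite leqNgt; apply/negP => Bfew.
have BE : B \in E by rewrite inE Bk eqxx.
by move: (S'E B BE); rewrite (fintype.subset_trans BA AS').
Qed.

(** * Transfer to finite sets of reals *)

Definition real_set (R : realType) (N : nat) (A : {set 'I_N}) : {fset R} :=
  [fset (val i)%:R | i in A]%fset.

Lemma card_real_set (R : realType) (N : nat) (A : {set 'I_N}) :
  #|` real_set R A| = #|A|.
Proof.
by rewrite card_imfset -?cardE // => i j /eqP; rewrite eqr_nat => /eqP /val_inj.
Qed.

Lemma real_setP (R : realType) (N : nat) (A : {set 'I_N}) (r : R) :
  reflect (exists2 i, i \in A & r = (val i)%:R) (r \in real_set R A).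
Proof. exact: (iffP (imfsetP _ _ _ _)). Qed.

Lemma sub_real_set (R : realType) (N : nat) (A : {set 'I_N}) (A' : {fset R}) :
  (A' `<=` real_set R A)%fset ->
  exists2 B : {set 'I_N}, B \subset A & A' = real_set R B.
Proof.
move=> A'A; exists [set i in A | (val i)%:R \in A'].
  by apply/fintype.subsetP => i; rewrite inE => /andP[].
apply/fsetP => r; apply/idP/real_setP => [rA'|[i]].
  have /real_setP[i iA ri] := fsubsetP A'A r rA'.
  by exists i; rewrite // inE iA -ri.
by rewrite inE => /andP[_ ?] ->.
Qed.

Lemma card_gaps_difference_set (R : realType) (N : nat) (B : {set 'I_N}) :
  (#|` gaps B| <= #|` difference_set (real_set R B)|)%N.
Proof.
have natr_inj : injective (fun d : nat => d%:R : R).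
  by move=> i j /eqP; rewrite eqr_nat => /eqP.
have <- : #|` [fset (d%:R : R) | d in gaps B]%fset| = #|` gaps B|.
  by rewrite card_imfset.
apply: fsubset_leq_card; apply/fsubsetP => r /imfsetP[d /imfsetP[[i j] /=]].
move=> /and3P[/= iB jB ij] -> ->; apply/imfset2P.
exists (val j)%:R; first by apply/real_setP; exists j.
exists (val i)%:R; last first.
  by rewrite natrB ?(ltnW ij) // ger0_norm // subr_ge0 ler_nat ltnW.
rewrite inE /= eqr_nat gtn_eqF // andbT.
by apply/real_setP; exists i.
Qed.

Lemma card_difference_set_real_set (R : realType) (N : nat) (A : {set 'I_N}) :
  (#|` difference_set (real_set R A)| <= N)%N.
Proof.
have sub : (difference_set (real_set R A) `<=` real_set R [set: 'I_N]%SET)%fset.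
  apply/fsubsetP => d /imfset2P[a /real_setP[i iA ->] [b /=]].
  rewrite inE => /andP[/real_setP[j jA ->] _] ->; apply/real_setP.
  wlog ij : i j {iA jA} / (j <= i)%N.
    move=> H; case: (leqP j i) => [/H //|/ltnW/H]; by rewrite distrC.
  have ltN : (i - j < N)%N by apply: leq_ltn_trans (leq_subr _ _) _.
  exists (Ordinal ltN); first by rewrite inE.
  by rewrite /= natrB // ger0_norm // subr_ge0 ler_nat.
by have := fsubset_leq_card sub; rewrite card_real_set cardsT card_ord.
Qed.

Lemma g_le (R : realType) (N n k L : nat) :
  (0 < N)%N -> (0 < k)%N -> (L.*2 <= k)%N -> (n.*2 <= N)%N ->
  (#|{set 'I_k * 'I_k * 'I_k * 'I_k}| * 2 ^ k * n ^ k.-1 <= N ^ (k - L))%N ->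
  (g n k (L%:R ^+ 2 : R) <= N%:R%:E)%E.
Proof.
move=> N0 k0 Lk nN CN; have [A An Agap] := few_gaps_free_set N0 k0 Lk nN CN.
apply: ge_ereal_inf; exists (#|` difference_set (real_set R A)|%:R)%:E.
  exists (real_set R A) => //; split; first by rewrite card_real_set.
  move=> A' /sub_real_set[B BA ->]; rewrite card_real_set => Bk.
  rewrite -natrX ler_nat (leq_trans (Agap B BA Bk)) //.
  exact: card_gaps_difference_set.
by rewrite lee_fin ler_nat card_difference_set_real_set.
Qed.

(** * Asymptotics and choice of parameters *)

Local Open Scope classical_set_scope.
Local Open Scope ring_scope.

Lemma near_powR_ge (R : realType) (d K : R) : 0 < d ->
  \forall n \near \oo, K <= n%:R `^ d.
Proof.
move=> d0; near=> n.
have : `|K| `^ d^-1 <= n%:R by near: n; exact: nbhs_infty_ger.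
move/(ge0_ler_powR (ltW d0)); rewrite !nnegrE powR_ge0 ler0n => /(_ isT isT).
rewrite -powRrM mulVf ?gt_eqF // powRr1 //; apply: le_trans; exact: ler_norm.
Unshelve. all: by end_near.
Qed.

Lemma near_g_le (R : realType) (k L : nat) (c e : R) :
  (0 < k)%N -> (L.*2 <= k)%N -> 1 < c -> k%:R - 1 < c * (k%:R - L%:R) -> 0 < e ->
  \forall n \near \oo, (g n k (L%:R ^+ 2 : R) <= (e * n%:R `^ c)%:E)%E.
Proof.
move=> k0 Lk c1 cL e0; have Lk' : (L <= k)%N by lia.
pose C := #|{set 'I_k * 'I_k * 'I_k * 'I_k}|.
(* As [N] will be at least [e n ^ c / 2], its power [N ^ (k - L)] is at least
   [a n ^ (c (k - L))]. *)
pose a := (e / 2) ^+ (k - L).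
have a0 : 0 < a by rewrite exprn_gt0 // divr_gt0.
rewrite -subr_gt0 in c1; rewrite -subr_gt0 in cL.
(* The first bound gives [2 n <= e n ^ c]; in the second, the surplus exponent [c (k - L) - (k - 1)]
   absorbs the constants. *)
apply: filterS3 _ (near_powR_ge (2 / e) c1)
  (near_powR_ge (C%:R * 2 ^+ k / a) cL) (nbhs_infty_gt 0%N) => n.
rewrite !ler_pdivrMr // => large1 large2 n_gt0.
have nR : 0 < n%:R :> R by rewrite ltr0n.
set y := e * _; pose N := Num.truncn y.
have hy : 2 * n%:R <= y.
  rewrite /y (_ : c = (c - 1) + 1); last by rewrite subrK.
  rewrite powRD ?(gt_eqF nR) ?implybT // powRr1 ?(ltW nR) // mulrA ler_pM2r // mulrC.
  exact: large1.
have y0 : 0 <= y by apply: le_trans hy; rewrite mulr_ge0.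
have Ny : N%:R <= y by rewrite -truncn_ge_nat.
have yN : y < N.+1%:R by rewrite -truncn_lt_nat.
have nN : (n.*2 <= N)%N.
  by rewrite truncn_ge_nat // -mul2n natrM.
have N_gt0 : (0 < N)%N by apply: leq_trans nN; rewrite double_gt0.
have yN2 : y / 2 <= N%:R.
  have : 1 <= N%:R :> R by rewrite ler1n.
  by move: yN; rewrite -natr1; lra.
apply: (@le_trans _ _ (N%:R%:E)); last by rewrite lee_fin.
apply: g_le => //.
rewrite -/C -(ler_nat R) natrX !natrM !natrX.
apply: (@le_trans _ _ ((y / 2) ^+ (k - L))); last first.
  by rewrite lerXn2r ?nnegrE ?divr_ge0.
rewrite (_ : y / 2 = e / 2 * n%:R `^ c); last by rewrite /y mulrAC.
rewrite exprMn -/a -[_ `^ c ^+ _]powR_mulrn ?powR_ge0 // -powRrM natrB //.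
rewrite -[leLHS]mulr1.
have -> : c * (k%:R - L%:R) = (c * (k%:R - L%:R) - (k%:R - 1)) + k.-1%:R.
  by rewrite -subn1 natrB //; ring.
rewrite powRD ?(gt_eqF nR) ?implybT // powR_mulrn ?(ltW nR) // mulr1 mulrA.
by rewrite ler_pM2r ?exprn_gt0 // [leRHS]mulrC.
Qed.

Lemma g_ge0 (R : realType) (n k : nat) (l : R) : (0 <= g n k l)%E.
Proof. by apply/ereal_infP => _ [A _ <-]; rewrite lee_fin. Qed.

(* [fine +oo = 0], hence the separate finiteness clause. *)
Theorem theorem1p6 (R : realType) (k : nat) (c : R)
    (k_gt0 : (0 < k)%N) (c_gt1 : 1 < c) (c_le2 : c <= 2) :
  let l : R := (Num.ceil ((c - 1) * (k%:R - 1) / c))%:~R ^+ 2 in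
  (\forall n \near \oo, g n k l \is a fin_num) /\
  (fun n : nat => fine (g n k l)) =o_\oo (fun n : nat => n%:R `^ c).
Proof.
move=> l; set t : R := (c - 1) * (k%:R - 1) / c in l *.
have k1 : 1 <= k%:R :> R by rewrite ler1n.
have c0 : 0 < c by apply: lt_trans c_gt1.
have tc : t * c = (c - 1) * (k%:R - 1) by rewrite divfK ?gt_eqF.
have t0 : 0 <= t by rewrite divr_ge0 ?mulr_ge0 ?subr_ge0 // ltW.
pose L := `|Num.ceil t|%N.
have ceilL : (Num.ceil t)%:~R = L%:R :> R.
  by rewrite natr_absz ger0_norm // ceil_ge0 (lt_le_trans _ t0) // ltrN10.
have Lt : L%:R < t + 1.
  by have := ceilB1_lt t; rewrite intrB ceilL ltrBlDr.
(* Here [c <= 2] enters: [t = (1 - 1 / c) (k - 1)]. With [L < t + 1] this gives [2 L < k + 1]. *)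
have t2 : t * 2 <= k%:R - 1 by nra.
have Lk : (L.*2 <= k)%N.
  by rewrite -ltnS -(ltr_nat R) -addnn natrD -natr1; lra.
(* From [L < t + 1] follows [c (k - L) > c (k - 1) - c t], and the right side equals [k - 1] by
   [tc]. *)
have cL : k%:R - 1 < c * (k%:R - L%:R) by nra.
rewrite /l ceilL.
have bound := near_g_le k_gt0 Lk c_gt1 cL.
split.
  apply: filterS (bound 1 ltr01) => n gn.
  by rewrite ge0_fin_numE ?g_ge0 // (le_lt_trans gn) // ltry.
apply/eqoP => e e0; apply: filterS (bound e e0) => n gn.
rewrite !ger0_norm ?powR_ge0 ?fine_ge0 ?g_ge0 //.
by rewrite -lee_fin fineK // ge0_fin_numE ?g_ge0 // (le_lt_trans gn) // ltry.
Qed.
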